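(* Let $D \subset \mathbb{R}^d$ be a domain and let $\mathcal{G}_\theta: H^s(D) \rightarrow H^t(D)$ be a neural operator parameterized by $\theta$. Suppose that $\mathcal{G}_\theta$ satisfies the Lipschitz continuity condition $$\|\mathcal{G}_\theta(u) - \mathcal{G}_\theta(v)\|_{H^t(D)} \leq L \|u - v\|_{H^s(D)}$$ for all $u, v \in H^s(D)$ and some Lipschitz constant $L > 0$. Then, for any $u \in H^s(D)$, $$\|\mathcal{G}_\theta(u)\|_{H^t(D)} \leq L \|u\|_{H^s(D)} + C,$$ where $C = \|\mathcal{G}_\theta(0)\|_{H^t(D)}$ is a constant depending on $\theta$ and the domain $D$.
   Context: For a domain $D \subset \mathbb{R}^d$ and $s \ge 0$, the Sobolev space $H^s(D)$ consists of functions $u: D \to \mathbb{R}$ whose weak derivatives up to order $s$ are square-integrable, with norm $\|u\|_{H^s(D)} = \left(\sum_{|\alpha| \le s} \int_D |D^\alpha u(x)|^2\,dx\right)^{1/2}$, where $\alpha$ is a multi-index and $D^\alpha$ is the weak derivative of order $\alpha$; similarly for $H^t(D)$. A neural operator $\mathcal{G}_\theta: U \to V$ between Banach spaces of functions over $D$ is a parameterized mapping, with parameters $\theta$ (designed to approximate a target operator $\mathcal{T}: U \to V$). Here $U = H^s(D)$ and $V = H^t(D)$. *)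

(* Defs.v *)
From HB Require Import structures.
From mathcomp Require Export all_boot all_order all_algebra.
From mathcomp Require Export all_classical all_reals all_analysis measurable_realfun.
From mathcomp Require Import ring.
Import Order.TTheory GRing.Theory Num.Theory.
Import numFieldNormedType.Exports.

Set Implicit Arguments.
Unset Strict Implicit.
Unset Printing Implicit Defensive.

Local Open Scope classical_set_scope.
Local Open Scope ring_scope.

(** The library has neither a measurable structure on 'rV[R]_d nor Lebesgue
    measure on it.  The sigma-algebra below is generated by the coordinates;
    it is the Borel one, as 'rV[R]_d is second countable.  *)
Definition rV_display : measure_display.
Proof. exact. Qed.

Section rV_measurable.
Context {R : realType} (d : nat).

Let coord (i : 'I_d) (x : 'rV[R]_d) : R := x ord0 i.

Let rV_set0 : g_sigma_preimage coord set0.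
Proof. exact: sigma_algebra0. Qed.

Let rV_setC A : g_sigma_preimage coord A -> g_sigma_preimage coord (~` A).
Proof. exact: sigma_algebraC. Qed.

Let rV_bigcup (F : _^nat) : (forall i, g_sigma_preimage coord (F i)) ->
  g_sigma_preimage coord (\bigcup_i (F i)).
Proof. exact: sigma_algebra_bigcup. Qed.

HB.instance Definition _ := @isMeasurable.Build rV_display 'rV[R]_d
  (g_sigma_preimage coord) rV_set0 rV_setC rV_bigcup.

Lemma measurable_coord (i : 'I_d) :
  measurable_fun [set: 'rV[R]_d] (fun x : 'rV[R]_d => x ord0 i).
Proof.
move=> _ Y mY; rewrite setTI; apply: sub_sigma_algebra => /=.
rewrite -bigcup_seq/=; exists i => /=; first by rewrite mem_index_enum.
by exists Y => //; rewrite setTI.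
Qed.

Lemma measurable_fun_rVP d' (T : measurableType d') (f : T -> 'rV[R]_d) :
  (forall i, measurable_fun [set: T] (fun t => f t ord0 i)) ->
  measurable_fun [set: T] f.
Proof.
move=> mf; apply: (@measurability _ _ _ _ _ _
  (\big[setU/set0]_(i < d) preimage_set_system setT (coord i) measurable)) => //.
move=> _ [X + <-]; rewrite -bigcup_seq => -[i _ [B mB <-]].
by rewrite [X in f @^-1` X]setTI; exact: (mf i measurableT B mB).
Qed.

Lemma rV_ball_measurable (x : 'rV[R]_d) (e : R) : measurable (ball x e).
Proof.
have [e0|e0] := ltP 0 e; last first.
  rewrite (_ : ball x e = set0)//; apply/seteqP; split => // y.
  by move=> -[e0']; move: (lt_le_trans e0' e0); rewrite ltxx.
rewrite (_ : ball x e =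
   \bigcap_(i in [set: 'I_d]) (coord i @^-1` ball (x ord0 i) e)).
  apply: fin_bigcap_measurable => // i _.
  rewrite -[_ @^-1` _]setTI; apply: measurable_coord => //.
  by apply: open_measurable; exact: ball_open.
apply/seteqP; split => [y [_ xy] i _|y xy]; first exact: xy.
by split=> // i j; rewrite ord1; exact: xy.
Qed.

Lemma rV_open_measurable (A : set 'rV[R]_d) : open A -> measurable A.
Proof.
move=> oA.
pose c (q : 'rV[rat]_d) : 'rV[R]_d := map_mx ratr q.
pose B (p : 'rV[rat]_d * nat) : set 'rV[R]_d := ball (c p.1) p.2.+1%:R^-1.
rewrite (_ : A = \bigcup_(p in [set p | B p `<=` A]) B p).
  rewrite bigcup_mkcond.
  pose F (n : nat) : set 'rV[R]_d :=
    if unpickle n is Some p then if p \in [set p | B p `<=` A] then B p else set0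
    else set0.
  rewrite (_ : \bigcup_p _ = \bigcup_n F n).
    apply: bigcupT_measurable => n; rewrite /F.
    case: unpickle => // p; case: ifP => // _; exact: rV_ball_measurable.
  apply/seteqP; split => [y [p _ pBy]|y [n _]].
    by exists (pickle p) => //; rewrite /F pickleK.
  by rewrite /F; case: unpickle => // p yp; exists p.
apply/seteqP; split => [x Ax|x [p] /=]; last exact.
have /nbhs_ballP[e /= e0 xeA] := open_nbhs_nbhs (conj oA Ax).
pose n := Num.truncn (2 / e).
have ne : n.+1%:R^-1 < e / 2.
  rewrite -[X in _ < X]invrK ltf_pV2 ?posrE ?invr_gt0 ?divr_gt0//.
  rewrite invf_div; exact: truncnS_gt.
have n0 : 0 < n.+1%:R^-1 :> R by rewrite invr_gt0.
have /choice[q xq] : forall i, exists q : rat,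
    ball (x ord0 i) n.+1%:R^-1 (ratr q : R).
  move=> i.
  have Bx0 : ball (x ord0 i) n.+1%:R^-1 !=set0.
    by exists (x ord0 i); exact: ballxx.
  have [y [xy [q _ qy]]] := dense_rat Bx0 (ball_open _ _).
  by exists q; rewrite qy.
exists (\row_i q i, n) => /=; rewrite /B /=.
  move=> y qy; apply: xeA; apply: (@ball_split _ _ (c (\row_i q i))).
    apply: (le_ball (ltW ne)); split => // i j.
    by rewrite !mxE ord1; exact: xq.
  exact: (le_ball (ltW ne)).
split => // i j; rewrite !mxE ord1; apply: ball_sym; exact: xq.
Qed.

End rV_measurable.

Section lebesgue_rV.
Context {R : realType}.

(** Lebesgue measure on R^d, by recursion on d: the image of the product
    measure on R^(d-1) * R (and the point mass on R^0).  [lebesgue_rV_box]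
    gives its value on boxes.  *)
Definition rV_cons d (z : 'rV[R]_d * measurableTypeR R) : 'rV[R]_d.+1 :=
  \row_i if unlift ord0 i is Some j then z.1 ord0 j else z.2.

Lemma measurable_rV_cons d : measurable_fun [set: 'rV[R]_d * measurableTypeR R] (@rV_cons d).
Proof.
apply: measurable_fun_rVP => i; rewrite /rV_cons.
under eq_fun do rewrite mxE.
case: unlift => [j|]; last exact: measurable_snd.
exact: (measurableT_comp (measurable_coord j)).
Qed.

HB.instance Definition _ d := isMeasurableFun.Build _ _ _ _ (@rV_cons d)
  (@measurable_rV_cons d).

Definition lebesgue_rVS d (m : {measure set 'rV[R]_d -> \bar R}) :=
  pushforward (m \x @lebesgue_measure R)%E (@rV_cons d).

HB.instance Definition _ d (m : {measure set 'rV[R]_d -> \bar R}) :=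
  Measure.copy (lebesgue_rVS m)
    (measure_function_pushforward__canonical__measure_function_Measure
      (m \x @lebesgue_measure R)%E (@measurable_rV_cons d)).

Fixpoint lebesgue_rV d : {measure set 'rV[R]_d -> \bar R} :=
  match d with
  | 0 => \d_(0 : 'rV[R]_0)
  | d'.+1 => lebesgue_rVS (lebesgue_rV d')
  end.

Lemma lebesgue_rV_box d (A : 'I_d -> set R) : (forall i, measurable (A i)) ->
  lebesgue_rV d [set x | forall i, A i (x ord0 i)] =
  (\prod_(i < d) lebesgue_measure (A i))%E.
Proof.
elim: d A => [|d ih] A mA.
  rewrite big_ord0 /= diracE mem_set//= => i; by case: i.
rewrite big_ord_recl /= /lebesgue_rVS /pushforward.
rewrite (_ : _ @^-1` _ =
   [set x : 'rV[R]_d | forall i, A (lift ord0 i) (x ord0 i)] `*` A ord0).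
  rewrite product_measure1E//.
    rewrite muleC; congr (_ * _)%E.
    exact: (ih (fun i => A (lift ord0 i))).
  rewrite (_ : mkset _ = \bigcap_(i in [set: 'I_d])
      ((fun x : 'rV[R]_d => x ord0 i) @^-1` A (lift ord0 i))).
    apply: fin_bigcap_measurable => // i _.
    by rewrite -[_ @^-1` _]setTI; exact: measurable_coord.
  by apply/seteqP; split => [x xA i _|x xA i]; exact: xA.
  exact: mA.
apply/seteqP; split => [[x y] /= xyA|[x y] /= [xA yA] i].
  split=> [i|].
    by have := xyA (lift ord0 i); rewrite /rV_cons mxE liftK.
  by have := xyA ord0; rewrite /rV_cons mxE unlift_none.
rewrite /rV_cons mxE; case: unliftP => [j ->|->]//=.
Qed.

End lebesgue_rV.

Section weak_derivative.
Context {R : realType} (d : nat).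
Implicit Types (D : set 'rV[R]_d) (u v w f phi : 'rV[R]_d -> R).
Implicit Types (alpha : {ffun 'I_d -> nat}).

Local Notation mu := (lebesgue_rV d).

(** [partials [:: i1; ..; ik] f] is the classical iterated partial derivative
    d_i1 (.. (d_ik f)).  The total operator 'D_v is only meaningful where
    [derivable] holds, hence the second clause of [smooth].  *)
Definition partials (l : seq 'I_d) f : 'rV[R]_d -> R :=
  foldr (fun i g x => 'D_(delta_mx ord0 i) g x) f l.

Definition smooth f := forall l : seq 'I_d,
  continuous (partials l f) /\
  forall i x, derivable (partials l f) x (delta_mx ord0 i).

Definition mlen alpha : nat := (\sum_(i < d) alpha i)%N.

(** For smooth f the order in which the partial derivatives are taken is
    irrelevant.  *)
Definition mpartial alpha f : 'rV[R]_d -> R :=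
  partials (flatten [seq nseq (alpha i) i | i <- enum 'I_d]) f.

Definition support f : set 'rV[R]_d := closure [set x | f x != 0].

Definition test_function D phi :=
  [/\ smooth phi, compact (support phi) & support phi `<=` D].

Definition loc_integrable D u :=
  measurable_fun D u /\
  forall K, compact K -> K `<=` D -> mu.-integrable K (EFin \o u).

Definition weak_derivative D alpha u w :=
  [/\ loc_integrable D u, loc_integrable D w &
    forall phi, test_function D phi ->
      \int[mu]_(x in D) (u x * mpartial alpha phi x) =
      (-1) ^+ mlen alpha * \int[mu]_(x in D) (w x * phi x)].

(** Weak derivatives are unique up to a null subset of D only; this picks one
    (and is the zero function if there is none).  *)
Definition weak_deriv D alpha u : 'rV[R]_d -> R :=
  xget (cst 0) [set w | weak_derivative D alpha u w].

Definition square_integrable D u :=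
  measurable_fun D u /\ (\int[mu]_(x in D) (`|u x| ^+ 2)%:E < +oo)%E.

Lemma support_measurable f : measurable (support f).
Proof.
rewrite -[support f]setCK; apply: measurableC; apply: rV_open_measurable.
by rewrite openC; exact: closed_closure.
Qed.

Lemma notin_support f x : ~ support f x -> f x = 0.
Proof.
by move=> fx; apply/eqP/negPn/negP => fx0; apply: fx; exact: subset_closure.
Qed.

Lemma partials_notin_support l f x : ~ support f x -> partials l f x = 0.
Proof.
elim: l x => [|i l ih] x fx /=; first exact: notin_support.
rewrite (@near_eq_derive _ _ _ _ (cst 0)) ?derive_cst//.
have oU : open (~` support f) by rewrite openC; exact: closed_closure.
by apply: filterS (open_nbhs_nbhs (conj oU fx)) => y; exact: ih.
Qed.

Lemma continuous_rV_measurable D f : continuous f -> measurable_fun D f.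
Proof.
move=> cf; apply: (@measurable_funS _ _ _ _ setT) => //.
apply: (measurability _ (RGenOpens.measurableE R)).
move=> _ [_ [a [b ->] <-]]; rewrite setTI; apply: rV_open_measurable.
by apply: open_comp => [x _|]; [exact: cf|exact: interval_open].
Qed.

Lemma test_integrable D u phi l : measurable D ->
  loc_integrable D u -> test_function D phi ->
  mu.-integrable D (EFin \o (fun x => u x * partials l phi x)).
Proof.
move=> mD [_ iu] [sphi cK KD]; have mK := support_measurable phi.
have [cpl _] := sphi l.
have iK : mu.-integrable (support phi)
    (EFin \o (fun x => u x * partials l phi x)).
  rewrite (_ : _ \o _ = (EFin \o partials l phi) \* (EFin \o u))%E; last first.
    by apply/funext => x /=; rewrite mulrC EFinM.
  apply: integrableMr => //; last exact: iu.
    exact: continuous_rV_measurable.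
  have ck : compact [set partials l phi x | x in support phi].
    by apply: continuous_compact => //; exact: continuous_subspaceT.
  have [M [_ mrt]] := compact_bounded ck.
  by exists M; split; rewrite ?num_real // => y My x Kx; apply: (mrt y My); exists x.
apply/(integrable_mkcond _ mD).
move/(integrable_mkcond _ mK) : iK; congr (_.-integrable _ _).
apply/funext => x; rewrite !patchE; case: ifPn => xK; case: ifPn => xD //.
  by move: xD; rewrite notin_setE => /(_ (KD x (set_mem xK))).
by rewrite /= partials_notin_support ?mulr0//; rewrite notin_setE in xK.
Qed.

Lemma loc_integrableB D u v : loc_integrable D u -> loc_integrable D v ->
  loc_integrable D (u - v).
Proof.
move=> [mu_ iu] [mv iv]; split; first exact: measurable_funB.
move=> K cK KD.
have mK : measurable K.
  rewrite -[K]setCK; apply: measurableC; apply: rV_open_measurable.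
  by rewrite openC; apply: compact_closed => //; exact: norm_hausdorff.
exact: (integrableB mK (iu K cK KD) (iv K cK KD)).
Qed.

Lemma weak_derivative0 D alpha : measurable D -> weak_derivative D alpha 0 0.
Proof.
have l0 : loc_integrable D 0.
  split; first exact: measurable_cst.
  move=> K _ _; rewrite (_ : EFin \o 0 = cst 0%E)//; exact: integrable0.
move=> mD; split=> // phi _.
under eq_Rintegral do rewrite mul0r.
under [in RHS]eq_Rintegral do rewrite mul0r.
by rewrite Rintegral_cst// mul0r mulr0.
Qed.

Lemma weak_derivativeB D alpha u1 u2 w1 w2 : measurable D ->
  weak_derivative D alpha u1 w1 -> weak_derivative D alpha u2 w2 ->
  weak_derivative D alpha (u1 - u2) (w1 - w2).
Proof.
move=> mD [lu1 lw1 h1] [lu2 lw2 h2]; split; [exact: loc_integrableB..|].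
move=> phi tphi.
under eq_Rintegral do rewrite mulrBl.
under [in RHS]eq_Rintegral do rewrite mulrBl.
rewrite !RintegralB//; first by rewrite h1// h2// mulrBr.
- exact: (@test_integrable _ _ _ [::]).
- exact: (@test_integrable _ _ _ [::]).
- exact: test_integrable.
- exact: test_integrable.
Qed.

Lemma square_integrable0 D : square_integrable D 0.
Proof.
split; first exact: measurable_cst.
by rewrite integral0_eq// => x _; rewrite normr0 expr0n.
Qed.

Lemma square_integrableB D u v : measurable D ->
  square_integrable D u -> square_integrable D v -> square_integrable D (u - v).
Proof.
move=> mD [mu_ iu] [mv iv]; split; first exact: measurable_funB.
have msq f : measurable_fun D f -> measurable_fun D (fun x => (`|f x| ^+ 2)%:E).
  move=> mf; apply/measurable_EFinP; apply: measurable_funX.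
  exact: measurableT_comp.
have sq0 f x : (0 <= (`|f x| ^+ 2)%:E)%E by rewrite lee_fin exprn_ge0.
apply: (@le_lt_trans _ _ (\int[mu]_(x in D)
    (2%:E * ((`|u x| ^+ 2)%:E + (`|v x| ^+ 2)%:E)))%E).
  apply: ge0_le_integral => //.
  - by apply: msq; exact: measurable_funB.
  - apply: measurable_funeM; apply: emeasurable_funD; exact: msq.
  - move=> x _; rewrite -EFinD -EFinM lee_fin !real_normK ?num_real//.
    rewrite -subr_ge0 (_ : _ - _ = (u x + v x) ^+ 2) ?sqr_ge0//.
    by have -> : (u - v) x = u x - v x by []; ring.
rewrite ge0_integralZl//; last 2 first.
- by apply: emeasurable_funD; exact: msq.
- by move=> x _; rewrite adde_ge0.
rewrite ge0_integralD//; [|exact: msq|exact: msq].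
by rewrite lte_mul_pinfty// lte_add_pinfty.
Qed.

End weak_derivative.

(** A domain is a nonempty connected open set.  *)
Record domain (R : realType) (d : nat) := Domain {
  domain_set :> set 'rV[R]_d ;
  domain_neq0 : domain_set !=set0 ;
  domain_open : open domain_set ;
  domain_connected : connected domain_set }.

(** Functions on D are represented by total functions on R^d whose values
    outside D play no role: they are not constrained by [sobolev_fun_pred] and
    are forgotten in the quotient by [sobolev_null].  The order s is any real
    number; only the condition |alpha| <= s depends on it.  In particular
    this is not the fractional Sobolev space when s is not an integer.  *)
Section sobolev.
Context {R : realType} {d : nat}.
Variables (D : domain R d) (s : R).

Local Notation mu := (lebesgue_rV d).

Definition multi_index : set {ffun 'I_d -> nat} :=
  [set alpha | (mlen alpha)%:R <= s].

Lemma finite_multi_index : finite_set multi_index.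
Proof.
pose n := Num.truncn s.
pose g (a : {ffun 'I_d -> 'I_n.+1}) : {ffun 'I_d -> nat} := [ffun i => val (a i)].
apply: (@sub_finite_set _ _ (range g)); last exact/finite_image/finite_finset.
move=> alpha /= sa; exists [ffun i => inord (alpha i)] => //.
apply/ffunP => i; rewrite !ffunE /= inordK// ltnS.
have ai : (alpha i <= mlen alpha)%N by rewrite /mlen (bigD1 i)//= leq_addr.
apply: (leq_trans ai); rewrite -(ler_nat R) in ai.
by rewrite truncn_ge_nat ?(le_trans _ sa).
Qed.

Definition sobolev_fun_pred : {pred 'rV[R]_d -> R} := mem [set u : 'rV[R]_d -> R |
  forall alpha, multi_index alpha ->
    exists2 w, weak_derivative D alpha u w & square_integrable D w].

Lemma sobolev_fun_zmod_closed : zmod_closed sobolev_fun_pred.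
Proof.
have mD : measurable D by apply: rV_open_measurable; exact: domain_open.
split=> [|u v]; rewrite !inE /=.
  move=> alpha _; exists 0; first exact: weak_derivative0.
  exact: square_integrable0.
move=> hu hv alpha sa; have [wu uwu iwu] := hu _ sa; have [wv vwv iwv] := hv _ sa.
by exists (wu - wv); [exact: weak_derivativeB|exact: square_integrableB].
Qed.

HB.instance Definition _ := GRing.isZmodClosed.Build ('rV[R]_d -> R)
  sobolev_fun_pred sobolev_fun_zmod_closed.

Record sobolev_fun := SobolevFun {
  sobolev_val :> 'rV[R]_d -> R ;
  _ : sobolev_val \in sobolev_fun_pred }.

HB.instance Definition _ := [isSub for sobolev_val].
HB.instance Definition _ := [Choice of sobolev_fun by <:].
HB.instance Definition _ := [SubChoice_isSubZmodule of sobolev_fun by <:].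

Definition sobolev_null : {pred sobolev_fun} :=
  mem [set u : sobolev_fun | {ae mu, forall x, domain_set D x -> u x = 0}].

Lemma sobolev_null_zmod_closed : zmod_closed sobolev_null.
Proof.
split=> [|u v]; rewrite !inE /=; first by apply: aeW.
move=> u0 v0; apply: filterS2 u0 v0 => x ux vx Dx.
by change (u x - v x = 0); rewrite ux// vx// subr0.
Qed.

HB.instance Definition _ := GRing.isZmodClosed.Build sobolev_fun
  sobolev_null sobolev_null_zmod_closed.

(** H^s(D), whose elements are classes of functions equal almost everywhere
    on D.  *)
Definition sobolev : zmodType := Quotient.quot sobolev_null.

(** Equal classes have the same weak derivatives, so that the representative
    is irrelevant; the sum is finite by [finite_multi_index].  *)
Definition sobolev_norm (u : sobolev) : R :=
  Num.sqrt (\sum_(alpha \in multi_index)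
    \int[mu]_(x in D) `|weak_deriv D alpha (repr u : sobolev_fun) x| ^+ 2).

End sobolev.

(* Main.v *)
Require Import Defs.
From mathcomp Require Import ring.
Import Order.TTheory GRing.Theory Num.Theory.
Import numFieldNormedType.Exports.

Set Implicit Arguments.
Unset Strict Implicit.
Unset Printing Implicit Defensive.

Local Open Scope classical_set_scope.
Local Open Scope ring_scope.

(** Writing G(u) = (G(u) - G(0)) + G(0), the bound is the Lipschitz condition at
    the pair (u, 0) together with the triangle inequality for the Sobolev norm
    ([sobolev_normD]), and all the work is in that inequality.

    The norm is computed on a chosen representative of each class and on chosen
    weak derivatives of it, and neither choice is additive.  Additivity holds
    only almost everywhere on D, and that rests on the uniqueness of weak
    derivatives ([weak_derivative_ae0]), that is, on the fundamental lemma of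
    the calculus of variations ([fundamental_lemma]): a locally integrable w
    that integrates to 0 against every test function vanishes almost everywhere
    on D.  The same uniqueness shows that the chosen weak derivative is the
    square integrable one, without which its integral would be meaningless.

    For the fundamental lemma, let h be the flat function equal to exp(-1/x) for
    x > 0 and to 0 elsewhere.  When the closed box of corners a and b lies in D,
    the functions prod_i h(n(x_i - a_i)) h(n(b_i - x_i)) are test functions,
    bounded by 1, which converge to the indicator of the open box; by dominated
    convergence w integrates to 0 over that box ([box_integral0]).  As w then
    integrates to 0 over all the sub-boxes, which form a pi-system generating the
    measurable subsets, it vanishes almost everywhere on the box ([box_ae0]), and
    countably many rational boxes cover D.

    Once the derivatives are known to add almost everywhere, the triangle
    inequality is Minkowski's inequality for a finite sum of L^2 norms.  It is
    obtained from the weighted inequality [youngD], which unlike the product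
    term of Cauchy-Schwarz is linear in the two squares, so that it passes
    unchanged through the integrals and through the sum over multi-indices. *)

(** * A smooth flat function *)

Section flat.
Context {R : realType}.
Implicit Types (p : {poly R}) (x y : R).

(** The polynomial factor makes the family stable under differentiation: every
    derivative of exp(-1/x) is a polynomial in 1/x times exp(-1/x). *)
Definition flat p x : R := if 0 < x then p.[x^-1] * expR (- x^-1) else 0.

Lemma flat_le0 p x : x <= 0 -> flat p x = 0.
Proof. by rewrite /flat ltNge => ->. Qed.

(** One term of the exponential series, that of degree n+1, already beats y^n
    with a factor y to spare. *)
Lemma monomial_expRN_le n y : 0 < y -> y ^+ n * expR (- y) <= n.+1`!%:R / y.
Proof.
move=> y0; rewrite expRN ler_pdivrMr ?expR_gt0// mulrAC ler_pdivlMr//.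
rewrite mulrC -exprS mulrC -ler_pdivrMr ?ltr0n ?fact_gt0//.
by apply: le_trans (expR_ge1Dxn n (ltW y0)); rewrite lerDr.
Qed.

(** Linear decay at 0 is enough: applied to p multiplied by 'X it controls the
    difference quotient of [flat p] at 0. *)
Lemma flat_bound p x :
  `|flat p x| <= (\sum_(i < size p) `|p`_i| * i.+1`!%:R) * `|x|.
Proof.
have S0 : 0 <= \sum_(i < size p) `|p`_i| * (i.+1)`!%:R.
  by apply: sumr_ge0 => i _; rewrite mulr_ge0.
rewrite /flat; case: ltP => x0; last by rewrite normr0 mulr_ge0.
rewrite horner_coef !mulr_suml; apply: le_trans (ler_norm_sum _ _ _) _.
apply: ler_sum => i _; rewrite -!mulrA normrM ler_wpM2l//.
rewrite ger0_norm ?(gtr0_norm x0); last first.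
  by rewrite mulr_ge0 ?expR_ge0// exprn_ge0// invr_ge0 ltW.
have ix : 0 < x^-1 by rewrite invr_gt0.
by have := monomial_expRN_le i ix; rewrite invrK.
Qed.

Lemma flat_cvg0 p : flat p x @[x --> (0 : R)] --> (0 : R).
Proof.
set S := \sum_(i < size p) `|p`_i| * i.+1`!%:R.
apply/norm_cvg0P; apply: (@squeeze_cvgr _ _ _ _ (cst 0) (fun x => S * `|x|)).
- by apply: nearW => x; rewrite normr_ge0 flat_bound.
- exact: cvg_cst.
- rewrite -[X in _ --> X](mulr0 S) -[X in _ --> S * X](@normr0 _ R).
  apply: cvgMl_tmp; exact: (@norm_continuous _ R).
Qed.

Definition flat_deriv p : {poly R} := 'X^2 * (p - p^`()).

(** Away from 0 this is the chain rule.  At 0 the difference quotient of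
    [flat p] is [flat (p * 'X)], which tends to 0. *)
Lemma is_derive_flat p x : is_derive x 1 (flat p) (flat (flat_deriv p) x).
Proof.
have [x0|x0|->] := ltgtP x 0.
- rewrite (flat_le0 _ (ltW x0)).
  apply: (@near_eq_is_derive _ _ _ (cst 0)).
  by near=> y; rewrite flat_le0//; apply/ltW; near: y; exact: lt_nbhsl.
- apply: (@near_eq_is_derive _ _ _ (fun y => p.[y^-1] * expR (- y^-1))).
    near=> y; rewrite /flat ifT//; near: y; exact: lt_nbhsr.
  have xN0 : x != 0 by rewrite gt_eqF.
  have dV : is_derive x 1 (fun y : R => y^-1) (- x ^- 2).
    apply: is_derive_eq (@is_deriveV _ id x 1 1 xN0 (is_derive_id _ _)) _.
    exact: mulr1.
  have dp := is_derive1_comp (is_derive_poly p x^-1) dV.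
  have de := @is_derive1_comp _ _ (fun y : R => - y^-1) _ _ _
    (is_derive_expR (- x^-1)) (is_deriveN dV).
  apply: is_derive_eq (is_deriveM dp de) _.
  rewrite /flat x0 !hornerE /= -!exprVn -![_ *: _]/(_ * _).
  ring.
- rewrite flat_le0//.
  have q0 : h^-1 *: ((flat p \o shift 0) (h *: 1) - flat p 0) @[h --> (0:R)^'] --> (0 : R).
    have -> : (fun h => h^-1 *: ((flat p \o shift 0) (h *: 1) - flat p 0)) =
              flat (p * 'X).
      apply/funext => h; rewrite /= addr0 [h *: _]mulr1 (flat_le0 p (lexx 0)) subr0.
      rewrite /flat; case: ifP => h0; last exact: mulr0.
      by rewrite hornerMX -[LHS]/(_ * _); ring.
    exact: cvg_within_filter (flat_cvg0 _).
  apply: DeriveDef; first by apply/cvg_ex; exists 0.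
  exact: cvg_lim q0.
Unshelve. all: by end_near. Qed.

Lemma is_derive_flat_dir p x v :
  is_derive x v (flat p) (v * flat (flat_deriv p) x).
Proof.
have [d1 e1] := is_derive_flat p x.
have df : differentiable (flat p) x by apply/derivable1_diffP.
apply: DeriveDef; first exact: diff_derivable.
rewrite -e1 !deriveE// -[in LHS](mulr1 v) -[v * 1]/(v *: (1:R)) linearZ.
by [].
Qed.

Lemma flat_continuous p : continuous (flat p).
Proof.
move=> x; apply: differentiable_continuous; apply/derivable1_diffP.
by case: (is_derive_flat p x).
Qed.
End flat.

(** * Smooth functions on R^d built from flat functions *)

Section flat_algebra.
Context {R : realType} {d : nat}.
Implicit Types (f g : 'rV[R]_d -> R).

(** A class of functions closed under products, which the bumps on boxes need,
    and stable under partial derivatives by construction, so that smoothness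
    needs no count of the order of differentiation. *)
Inductive flat_algebra : ('rV[R]_d -> R) -> Prop :=
| flat_algebra_cst c : flat_algebra (cst c)
| flat_algebra_coord p c e i : flat_algebra (fun x => flat p (c * x ord0 i + e))
| flat_algebraD f g : flat_algebra f -> flat_algebra g -> flat_algebra (f + g)
| flat_algebraM f g : flat_algebra f -> flat_algebra g -> flat_algebra (f * g).

Lemma flat_algebra_prod (I : Type) (r : seq I) (F : I -> 'rV[R]_d -> R) :
  (forall i, flat_algebra (F i)) -> flat_algebra (\prod_(i <- r) F i).
Proof.
move=> hF; elim/big_ind : _ => //; [exact: flat_algebra_cst 1|exact: flat_algebraM].
Qed.

(** Along a line, the function is [flat p] along a line of R, with the very same
    difference quotients. *)
Lemma is_derive_flat_coord p c e i (x v : 'rV[R]_d) :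
  is_derive x v (fun x => flat p (c * x ord0 i + e))
    (c * v ord0 i * flat (flat_deriv p) (c * x ord0 i + e)).
Proof.
set y := c * _ + e; set w := c * _; set F := fun _ => _.
have E : (fun h => h^-1 *: ((F \o shift x) (h *: v) - F x)) =
         (fun h => h^-1 *: ((flat p \o shift y) (h *: w) - flat p y)).
  apply/funext => h; rewrite /F /= !mxE; congr (_ *: (flat _ _ - _)).
  by rewrite -[_ *: w]/(_ * _) /w /y; ring.
have [] := is_derive_flat_dir p y w.
by move=> cv lv; apply: DeriveDef; rewrite /derivable /derive E.
Qed.

(** Induction on the construction: the Leibniz rule stays in the class because
    the class is closed under both sums and products. *)
Lemma flat_algebra_derive f (v : 'rV[R]_d) : flat_algebra f ->
  exists2 g, flat_algebra g & forall x, is_derive x v f (g x).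
Proof.
elim => [c|p c e i|f1 f2 A1 [g1 Ag1 D1] A2 [g2 Ag2 D2]|f1 f2 A1 [g1 Ag1 D1] A2 [g2 Ag2 D2]].
- by exists (cst 0); [exact: flat_algebra_cst|move=> x; exact: is_derive_cst].
- exists (cst (c * v ord0 i) * (fun x => flat (flat_deriv p) (c * x ord0 i + e))).
    by apply: flat_algebraM; [exact: flat_algebra_cst|exact: flat_algebra_coord].
  by move=> x; exact: is_derive_flat_coord.
- exists (g1 + g2); first exact: flat_algebraD.
  by move=> x; exact: is_deriveD.
- exists (f1 * g2 + f2 * g1); last by move=> x; exact: is_deriveM.
  by apply: flat_algebraD; exact: flat_algebraM.
Qed.

Lemma flat_algebra_continuous f : flat_algebra f -> continuous f.
Proof.
elim => [c|p c e i|f1 f2 _ c1 _ c2|f1 f2 _ c1 _ c2] x.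
- exact: cst_continuous.
- apply: (@continuous_comp _ _ _ (fun x : 'rV[R]_d => c * x ord0 i + e) (flat p)).
    apply: (@continuousD _ _ _ (fun x : 'rV[R]_d => c * x ord0 i) (cst e)).
      apply: (@continuousM _ _ (cst c) (fun x : 'rV[R]_d => x ord0 i)).
        exact: cst_continuous.
      exact: coord_continuous.
    exact: cst_continuous.
  exact: flat_continuous.
- by apply: continuousD; [exact: c1|exact: c2].
- by apply: continuousM; [exact: c1|exact: c2].
Qed.

Lemma flat_algebra_smooth f : flat_algebra f -> smooth f.
Proof.
move=> Af l; have {}Af : flat_algebra (partials l f).
  elim: l => // i l /= /(@flat_algebra_derive _ (delta_mx ord0 i))[g Ag Dg].
  by rewrite (_ : (fun x => _) = g)//; apply/funext => x; case: (Dg x).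
split; first exact: flat_algebra_continuous.
move=> i x; have [g _ Dg] := flat_algebra_derive (delta_mx ord0 i) Af.
by case: (Dg x).
Qed.
End flat_algebra.

(** * Rays and boxes *)

Section rays.
Context {R : realType} {d : nat}.

(** Rays are preferred to boxes as generators because the trace of a ray on a box
    is again a box, whose upper corner is unchanged. *)
Definition ray (a : 'I_d -> R) : set 'rV[R]_d := [set x | forall i, a i < x ord0 i].

Definition box (a b : 'I_d -> R) : set 'rV[R]_d :=
  [set x | forall i, a i < x ord0 i < b i].

Definition closed_box (a b : 'I_d -> R) : set 'rV[R]_d :=
  [set x | forall i, a i <= x ord0 i <= b i].

Lemma ray_box c a b : ray c `&` box a b = box (fun i => Num.max (c i) (a i)) b.
Proof.
apply/seteqP; split => [x [cx abx] i|x h]; first by rewrite gt_max cx; exact: abx.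
have {}h i : [/\ c i < x ord0 i, a i < x ord0 i & x ord0 i < b i].
  by have := h i; rewrite gt_max -andbA => /and3P.
by split=> i; have [cx ax xb] := h i; rewrite ?ax.
Qed.

Lemma ray_setI a b : ray a `&` ray b = ray (fun i => Num.max (a i) (b i)).
Proof.
apply/seteqP; split => [x [ax bx] i|x h]; first by rewrite gt_max ax bx.
by split=> i; have := h i; rewrite gt_max => /andP[].
Qed.

Lemma ray_cover : \bigcup_n ray (fun=> - n%:R) = setT.
Proof.
apply/seteqP; split => // x _.
exists (Num.truncn (\sum_(i < d) `|x ord0 i|)).+1 => // i.
rewrite ltrNl; apply: le_lt_trans (truncnS_gt _).
apply: (@le_trans _ _ `|x ord0 i|); first by rewrite -normrN ler_norm.
by rewrite (bigD1 i)//= lerDl sumr_ge0.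
Qed.

(** A half-space constrains one coordinate only; the others are freed by letting
    their bounds tend to minus infinity. *)
Lemma ray_coord (i : 'I_d) (c : R) :
  [set x : 'rV[R]_d | c < x ord0 i] =
  \bigcup_n ray (fun j => if j == i then c else - n%:R).
Proof.
apply/seteqP; split => [x /= cx|x [n _ /(_ i)]]; last by rewrite eqxx.
have : (\bigcup_n ray (fun=> - n%:R)) x by rewrite ray_cover.
by move=> [n _ nx]; exists n => // j; case: eqP => [->//|_]; exact: nx.
Qed.

Lemma ray_generates : @measurable _ 'rV[R]_d = <<s range ray >>.
Proof.
apply/seteqP; split; last first.
  apply: smallest_sub; first exact: sigma_algebra_measurable.
  move=> _ [a _ <-].
  rewrite (_ : ray a = \bigcap_(i in [set: 'I_d])
      ((fun x : 'rV[R]_d => x ord0 i) @^-1` `]a i, +oo[)).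
    apply: fin_bigcap_measurable => // i _.
    by rewrite -[_ @^-1` _]setTI; exact: measurable_coord.
  by apply/seteqP; split => x h i; [move=> _|]; have := h i; rewrite /= in_itv/= andbT//; exact.
apply: smallest_sub; first exact: smallest_sigma_algebra.
move=> A; rewrite -bigcup_seq => -[i _ [B mB <-]].
have := @measurability _ _ (g_sigma_algebraType (range ray)) _ setT
  (fun x : 'rV[R]_d => x ord0 i) _ (RGenOInfty.measurableE R).
apply => //.
move=> _ [_ [c ->] <-]; rewrite setTI.
rewrite (_ : _ @^-1` _ = [set x : 'rV[R]_d | c < x ord0 i]); last first.
  by apply/seteqP; split => x /=; rewrite in_itv/= andbT.
rewrite ray_coord; apply: bigcupT_measurable => n.
by apply: sub_sigma_algebra; eexists.
Qed.

Lemma box_measurable a b : measurable (box a b).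
Proof.
rewrite (_ : box a b = \bigcap_(i in [set: 'I_d])
    ((fun x : 'rV[R]_d => x ord0 i) @^-1` `]a i, b i[)).
  apply: fin_bigcap_measurable => // i _.
  by rewrite -[_ @^-1` _]setTI; exact: measurable_coord.
by apply/seteqP; split => x h i; [move=> _|]; have := h i; rewrite /= in_itv//; exact.
Qed.

Lemma closed_box_compact a b : compact (closed_box a b).
Proof.
have := @rV_compact R d (fun i => `[a i, b i]%classic) (fun i => @segment_compact _ _ _).
by congr compact; apply/seteqP; split => x h i; have := h i; rewrite /= in_itv.
Qed.

Lemma box_closed_box a b : box a b `<=` closed_box a b.
Proof. by move=> x h i; have /andP[/ltW-> /ltW->] := h i. Qed.

Definition ratv (q : 'rV[rat]_d) (i : 'I_d) : R := ratr (q ord0 i).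

Lemma open_rat_box (U : set 'rV[R]_d) x : open U -> U x ->
  exists2 p : 'rV[rat]_d * 'rV[rat]_d,
    box (ratv p.1) (ratv p.2) x & closed_box (ratv p.1) (ratv p.2) `<=` U.
Proof.
move=> oU Ux; have /nbhs_ballP[e /= e0 xeU] := open_nbhs_nbhs (conj oU Ux).
have /choice[q1 h1] (i : 'I_d) : exists q : rat, x ord0 i - e < ratr q < x ord0 i.
  have xe : x ord0 i - e < x ord0 i by rewrite ltrBlDr ltrDl.
  by have [q] := rat_in_itvoo xe; rewrite in_itv; exists q.
have /choice[q2 h2] (i : 'I_d) : exists q : rat, x ord0 i < ratr q < x ord0 i + e.
  have xe : x ord0 i < x ord0 i + e by rewrite ltrDl.
  by have [q] := rat_in_itvoo xe; rewrite in_itv; exists q.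
exists (\row_i q1 i, \row_i q2 i) => [i|y hy].
  by rewrite /ratv !mxE; have /andP[_ ->] := h1 i; have /andP[-> _] := h2 i.
apply: xeU; split => // j i; rewrite ord1 /ball /= ltr_distlC.
have := hy i; rewrite /ratv !mxE => /andP[ay yb].
have /andP[a1 _] := h1 i; have /andP[_ b1] := h2 i.
by rewrite (lt_le_trans a1 ay) (le_lt_trans yb b1).
Qed.
End rays.

(** * Test functions approximating the indicator of a box *)

Section bump.
Context {R : realType} {d : nat}.
Local Notation mu := (@lebesgue_rV R d).
Implicit Types (a b : 'I_d -> R) (x : 'rV[R]_d).

Lemma flat1_ge0 (t : R) : 0 <= flat 1 t.
Proof. by rewrite /flat; case: ifP => // _; rewrite hornerC mul1r expR_ge0. Qed.

Lemma flat1_le1 (t : R) : flat 1 t <= 1.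
Proof.
rewrite /flat; case: ifP => // t0; rewrite hornerC mul1r.
by rewrite -[leRHS]expR0 ler_expR oppr_le0 invr_ge0 ltW.
Qed.

(** Dilating exp(-1/t) makes it converge to the indicator of the positive reals,
    while it stays below 1; no normalisation of the bumps is then needed. *)
Lemma flat1_scale_cvg (t : R) : 0 < t -> flat 1 (n.+1%:R * t) @[n --> \oo] --> (1 : R).
Proof.
move=> t0; rewrite -[X in _ --> X]expR0.
rewrite (_ : (fun n => _) = (fun n => expR (- (t^-1 * harmonic n)))); last first.
  by apply/funext => n; rewrite /flat mulr_gt0// hornerC mul1r invfM mulrC.
have h : - (t^-1 * harmonic n) @[n --> \oo] --> (0 : R).
  rewrite -[X in _ --> X]oppr0 -[X in _ --> - X](mulr0 t^-1).
  by apply: cvgN; apply: cvgM; [exact: cvg_cst|exact: cvg_harmonic].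
by apply: cvg_comp h _; exact: continuous_expR.
Qed.

(** Written with affine forms c * x_i + e so as to be syntactically a product of
    generators of [flat_algebra]; [bumpE] gives the readable form. *)
Definition bump a b (n : nat) : 'rV[R]_d -> R :=
  \prod_(i < d) ((fun x => flat 1 (n.+1%:R * x ord0 i + - (n.+1%:R * a i))) *
                 (fun x => flat 1 (- n.+1%:R * x ord0 i + n.+1%:R * b i))).

Lemma bumpE a b n x : bump a b n x =
  \prod_(i < d) (flat 1 (n.+1%:R * (x ord0 i - a i)) *
                 flat 1 (n.+1%:R * (b i - x ord0 i))).
Proof.
rewrite /bump fct_prodE; apply: eq_bigr => i _ /=.
by congr (flat 1 _ * flat 1 _); ring.
Qed.

Lemma bump_smooth a b n : smooth (bump a b n).
Proof.
apply: flat_algebra_smooth; apply: flat_algebra_prod => i.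
by apply: flat_algebraM; exact: flat_algebra_coord.
Qed.

Lemma bump_ge0 a b n x : 0 <= bump a b n x.
Proof. by rewrite bumpE prodr_ge0// => i _; rewrite mulr_ge0 ?flat1_ge0. Qed.

Lemma bump_le1 a b n x : bump a b n x <= 1.
Proof.
rewrite bumpE -[leRHS](@big1_eq _ _ *%R _ (index_enum 'I_d) xpredT); apply: ler_prod => i _.
by rewrite mulr_ge0 ?flat1_ge0//= mulr_ile1 ?flat1_ge0 ?flat1_le1.
Qed.

Lemma bump_notin a b n x : ~ box a b x -> bump a b n x = 0.
Proof.
move=> /existsNP[i /negP xi]; rewrite bumpE (bigD1 i)//=.
have [ax|ax] := leP (x ord0 i) (a i).
  by rewrite flat_le0 ?mul0r// pmulr_rle0 ?ltr0n// subr_le0.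
rewrite [X in _ * X * _]flat_le0 ?mulr0 ?mul0r// pmulr_rle0 ?ltr0n// subr_le0.
by move: xi; rewrite ax/= -leNgt.
Qed.

Lemma bump_cvg a b x : box a b x -> bump a b n x @[n --> \oo] --> (1 : R).
Proof.
move=> xab; pose F i (n : nat) : R := flat 1 (n.+1%:R * (x ord0 i - a i)) *
  flat 1 (n.+1%:R * (b i - x ord0 i)).
have F1 i : F i n @[n --> \oo] --> (1 : R).
  have /andP[ax xb] := xab i.
  by rewrite -[X in _ --> X]mulr1; apply: cvgM; apply: flat1_scale_cvg; rewrite subr_gt0.
have h (r : seq 'I_d) : \prod_(i <- r) F i n @[n --> \oo] --> (1 : R).
  elim: r => [|i r ih].
    by under eq_fun do rewrite big_nil; exact: cvg_cst.
  rewrite (_ : (fun n => _) = F i \* (fun n => \prod_(j <- r) F j n)); last first.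
    by apply/funext => n; rewrite big_cons.
  suff : (F i \* (fun n => \prod_(j <- r) F j n)) @ \oo --> (1 * 1 : R).
    by rewrite mulr1.
  exact: cvgM (F1 i) ih.
by rewrite (_ : (fun n => bump a b n x) = fun n => \prod_(i < d) F i n)//;
  apply/funext => n; exact: bumpE.
Qed.

(** The support of the bump may touch the boundary of the box, whence the
    hypothesis on the closed box. *)
Lemma bump_test (D : set 'rV[R]_d) a b n :
  closed_box a b `<=` D -> test_function D (bump a b n).
Proof.
move=> abD.
have sab : support (bump a b n) `<=` closed_box a b.
  have /closure_id -> : closed (closed_box a b).
    by apply: compact_closed; [exact: norm_hausdorff|exact: closed_box_compact].
  apply: closureS => x /= /eqP bx; apply: box_closed_box.
  by apply: contrapT => /(@bump_notin _ _ n).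
split; [exact: bump_smooth| |exact: subset_trans abD].
by apply: subclosed_compact sab; [exact: closed_closure|exact: closed_box_compact].
Qed.
End bump.

(** * The fundamental lemma of the calculus of variations *)

Section fundamental_lemma.
Context {R : realType} {d : nat}.
Local Notation mu := (@lebesgue_rV R d).
Implicit Types (a b : 'I_d -> R) (x : 'rV[R]_d) (D : set 'rV[R]_d) (w : 'rV[R]_d -> R).

Lemma closed_box_measurable a b : measurable (closed_box a b).
Proof.
rewrite -[closed_box a b]setCK; apply: measurableC; apply: rV_open_measurable.
rewrite openC; apply: compact_closed; first exact: norm_hausdorff.
exact: closed_box_compact.
Qed.

Lemma box_integrable D w a b : loc_integrable D w -> closed_box a b `<=` D ->
  mu.-integrable (box a b) (EFin \o w).
Proof.
move=> [_ iw] abD.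
apply: (integrableS (closed_box_measurable a b)); first exact: box_measurable.
  exact: box_closed_box.
by apply: iw => //; exact: closed_box_compact.
Qed.

(** The bumps vanish off the box, so that their integrals against w over D are
    integrals over the box, where |w| is an integrable bound. *)
Lemma box_integral0 D w a b : measurable D -> loc_integrable D w ->
  (forall phi, test_function D phi -> \int[mu]_(x in D) (w x * phi x) = 0) ->
  closed_box a b `<=` D -> (\int[mu]_(x in box a b) (w x)%:E = 0)%E.
Proof.
move=> mD lw w0 abD.
have iB := box_integrable lw abD.
have mB : measurable (box a b) := box_measurable a b.
pose f n x : \bar R := (w x * bump a b n x)%:E.
have f0 n : (\int[mu]_(x in box a b) f n x = 0)%E.
  have tb := @bump_test _ _ _ _ _ n abD.
  have iD : mu.-integrable D (f n) := @test_integrable _ _ _ _ _ [::] mD lw tb.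
  have BD : box a b `<=` D := subset_trans (@box_closed_box _ _ a b) abD.
  rewrite -(setIidr BD) integral_mkcondr (_ : f n \_ _ = f n).
    by rewrite -(fineK (integrable_fin_num mD iD)); congr EFin; exact: w0 tb.
  apply/funext => x; rewrite patchE; case: ifPn => // /negP xB.
  by rewrite /f bump_notin ?mulr0// => xab; apply: xB; rewrite inE.
have mw : measurable_fun (box a b) w by apply/measurable_EFinP; exact: measurable_int iB.
have cvgf : (\int[mu]_(x in box a b) f n x)%E @[n --> \oo] -->
            (\int[mu]_(x in box a b) (w x)%:E)%E.
  apply: (@dominated_cvg _ _ _ mu (box a b) mB f (EFin \o w) (abse \o EFin \o w)) => //.
  - move=> n; apply/measurable_EFinP; apply: measurable_funM => //.
    apply: continuous_rV_measurable; exact: (bump_smooth a b n [::]).1.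
  - move=> x xB; apply: cvg_EFin; first exact: nearW.
    rewrite /= -[X in _ --> X]mulr1.
    by apply: cvgM; [exact: cvg_cst|exact: bump_cvg].
  - exact: integrable_abse.
  - move=> n x xB; rewrite /f /= lee_fin normrM (ger0_norm (bump_ge0 a b n x)).
    by rewrite ler_piMr// bump_le1.
rewrite -(cvg_lim _ cvgf)//; apply: cvg_lim => //.
by under eq_fun do rewrite f0; exact: cvg_cst.
Qed.

(** The sets over whose trace on the box w integrates to 0 form a Dynkin system
    containing the rays, hence contain all measurable sets; an integrable
    function whose integrals all vanish is null. *)
Lemma box_ae0 D w a b : measurable D -> loc_integrable D w ->
  (forall phi, test_function D phi -> \int[mu]_(x in D) (w x * phi x) = 0) ->
  closed_box a b `<=` D -> {ae mu, forall x, box a b x -> w x = 0}.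
Proof.
move=> mD lw w0 abD; have mB : measurable (box a b) := box_measurable a b.
have iB := box_integrable lw abD.
have mw : measurable_fun (box a b) (EFin \o w) := measurable_int _ iB.
have box0 c e : closed_box c e `<=` D -> (\int[mu]_(x in box c e) (w x)%:E = 0)%E.
  exact: box_integral0.
suff h : forall A, measurable A -> (\int[mu]_(x in A `&` box a b) (w x)%:E = 0)%E.
  have : ae_eq mu (box a b) (EFin \o w) (cst 0%E).
    apply: integral_ae_eq => //.
    by move=> E Eab mE; rewrite integral0 -[E](setIidl Eab); exact: h.
  by apply: filterS => x /= xw xB; have [] := xw xB.
move=> A; rewrite ray_generates.
apply: (@dynkin_induction _ _ (range ray)
  (fun A => (\int[mu]_(x in A `&` box a b) (w x)%:E = 0)%E)).
- exact: ray_generates.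
- by move=> _ _ [a1 _ <-] [a2 _ <-]; rewrite ray_setI; eexists.
- by rewrite setTI; exact: box0.
- move=> _ [c _ <-]; rewrite ray_box; apply: box0; apply: subset_trans abD => x xi i.
  by have := xi i; rewrite ge_max => /andP[/andP[_ ->]].
- move=> S mS S0.
  have E : box a b = (S `&` box a b) `|` (~` S `&` box a b).
    by rewrite -setIUl setUv setTI.
  have := box0 _ _ abD; rewrite {1}E integral_setU -?E//.
  + by rewrite S0 add0e.
  + exact: measurableI.
  + by apply: measurableI => //; exact: measurableC.
  + by rewrite disj_set2E; apply/eqP; rewrite setIACA setICr set0I.
- move=> F mF tF F0; rewrite setI_bigcupl integral_bigcup.
  + by apply: eseries0 => i _ _; exact: F0.
  + exact: trivIset_setIr.
  + by move=> k; exact: measurableI.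
  + apply: (integrableS mB) => //.
      by apply: bigcupT_measurable => k; exact: measurableI.
    by move=> x [k _ []].
Qed.

(** The exceptional set is covered by those of the countably many rational boxes
    whose closed box lies in D. *)
Lemma fundamental_lemma D w : open D -> loc_integrable D w ->
  (forall phi, test_function D phi -> \int[mu]_(x in D) (w x * phi x) = 0) ->
  {ae mu, forall x, D x -> w x = 0}.
Proof.
move=> oD lw w0; have mD := rV_open_measurable oD.
pose Q := ('rV[rat]_d * 'rV[rat]_d)%type.
pose B (p : Q) : set 'rV[R]_d := box (ratv p.1) (ratv p.2).
pose K (p : Q) : set 'rV[R]_d := closed_box (ratv p.1) (ratv p.2).
pose N n : set 'rV[R]_d :=
  if unpickle n is Some p then [set x | K p `<=` D /\ ~ (B p x -> w x = 0)] else set0.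
have : mu.-negligible (\bigcup_n N n).
  apply: negligible_bigcup => n; rewrite /N; case: unpickle => [p|]; last exact: negligible_set0.
  have [KD|KD] := pselect (K p `<=` D); last first.
    by apply: (negligibleS _ (negligible_set0 mu)) => x [].
  have Bp : mu.-negligible (~` [set x | B p x -> w x = 0]) := box_ae0 mD lw w0 KD.
  by apply: (negligibleS _ Bp) => x [].
apply: negligibleS => x /= /not_implyP[Dx wx].
have [p Bx KD] := open_rat_box oD Dx.
by exists (pickle p) => //; rewrite /N pickleK; split => // /(_ Bx).
Qed.

End fundamental_lemma.

(** * Uniqueness of weak derivatives *)

Section ae_Rintegral.
Context {dsp : measure_display} {T : measurableType dsp} {R : realType}.
Variable mu : {measure set T -> \bar R}.

Lemma ae_eq_Rintegral (D : set T) (f g : T -> R) : measurable D ->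
  measurable_fun D f -> measurable_fun D g ->
  {ae mu, forall x, D x -> f x = g x} ->
  \int[mu]_(x in D) f x = \int[mu]_(x in D) g x.
Proof.
move=> mD mf mg fg; rewrite /Rintegral; congr fine.
apply: ae_eq_integral => //; [exact/measurable_EFinP..|].
by apply: filterS fg => x /= fgx Dx; rewrite fgx.
Qed.
End ae_Rintegral.

Section weak_derivative_unique.
Context {R : realType} {d : nat}.
Local Notation mu := (@lebesgue_rV R d).
Implicit Types (D : set 'rV[R]_d) (u v w z : 'rV[R]_d -> R) (alpha : {ffun 'I_d -> nat}).

(** The weak derivatives of a null function integrate to 0 against every test
    function.  By linearity this contains the uniqueness of weak derivatives,
    and their independence of the representative of a class. *)
Lemma weak_derivative_ae0 D alpha z w : open D ->
  {ae mu, forall x, D x -> z x = 0} -> weak_derivative D alpha z w ->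
  {ae mu, forall x, D x -> w x = 0}.
Proof.
move=> oD z0 [lz lw zw]; have mD := rV_open_measurable oD.
apply: fundamental_lemma => // phi tphi.
have : (-1) ^+ mlen alpha * \int[mu]_(x in D) (w x * phi x) = 0.
  rewrite -zw// (@ae_eq_Rintegral _ _ _ mu D _ (cst 0)) //.
  - by rewrite Rintegral_cst// mul0r.
  - apply/measurable_EFinP; apply: (@measurable_int _ _ _ mu).
    exact: (@test_integrable _ _ _ _ _
      (flatten [seq nseq (alpha i) i | i <- enum 'I_d]) mD lz tphi).
  - by apply: filterS z0 => x zx Dx; rewrite zx// mul0r.
by move/eqP; rewrite mulf_eq0 signr_eq0 => /eqP.
Qed.

Lemma weak_derivative_ae_unique D alpha u w1 w2 : open D ->
  weak_derivative D alpha u w1 -> weak_derivative D alpha u w2 ->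
  {ae mu, forall x, D x -> w1 x = w2 x}.
Proof.
move=> oD u1 u2; have := weak_derivativeB (rV_open_measurable oD) u1 u2.
rewrite subrr => /(weak_derivative_ae0 oD) h.
have : {ae mu, forall x, D x -> (w1 - w2) x = 0} by apply: h; apply: aeW.
by apply: filterS => x hx /hx /eqP; rewrite -[(w1 - w2) x]/(w1 x - w2 x) subr_eq0 => /eqP.
Qed.

Lemma square_integrable_ae D w1 w2 : measurable D ->
  measurable_fun D w2 -> {ae mu, forall x, D x -> w1 x = w2 x} ->
  square_integrable D w1 -> square_integrable D w2.
Proof.
move=> mD m2 w12 [m1 i1]; split=> //.
rewrite (_ : integral _ _ _ = \int[mu]_(x in D) (`|w1 x| ^+ 2)%:E)%E//.
have msq (f : 'rV[R]_d -> R) : measurable_fun D f -> measurable_fun D (fun x => (`|f x| ^+ 2)%:E).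
  by move=> mf; apply/measurable_EFinP/measurable_funX/measurableT_comp.
apply: ae_eq_integral => //; [exact: msq..|].
by apply: filterS w12 => x /= w12x Dx; rewrite w12x.
Qed.

End weak_derivative_unique.

(** * An L^2 Minkowski inequality *)

Section minkowski.
Context {R : realType} {d : nat}.
Local Notation mu := (@lebesgue_rV R d).

Lemma square_integrable_integrable (D : set 'rV[R]_d) (w : 'rV[R]_d -> R) :
  square_integrable D w ->
  mu.-integrable D (EFin \o (fun x => `|w x| ^+ 2)).
Proof.
move=> [mw iw]; apply/integrableP; split.
  by apply/measurable_EFinP/measurable_funX/measurableT_comp.
by under eq_integral do rewrite /= ger0_norm ?exprn_ge0//.
Qed.

(** The difference of the two sides is the square of y p - x q over x y. *)
Lemma youngD (x y p q : R) : 0 < x -> 0 < y ->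
  `|p + q| ^+ 2 <= (x + y) / x * `|p| ^+ 2 + (x + y) / y * `|q| ^+ 2.
Proof.
move=> x0 y0; rewrite !real_normK ?num_real// -subr_ge0.
rewrite (_ : _ - _ = (y * p - x * q) ^+ 2 / (x * y)).
  by rewrite divr_ge0 ?sqr_ge0// mulr_ge0 ?ltW.
by field; rewrite !gt_eqF.
Qed.

Lemma Rintegral_youngD (D : set 'rV[R]_d) (w1 w2 : 'rV[R]_d -> R)
    (x y : R) :
  measurable D -> 0 < x -> 0 < y ->
  square_integrable D w1 -> square_integrable D w2 ->
  \int[mu]_(t in D) `|w1 t + w2 t| ^+ 2 <=
    (x + y) / x * \int[mu]_(t in D) `|w1 t| ^+ 2 +
    (x + y) / y * \int[mu]_(t in D) `|w2 t| ^+ 2.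
Proof.
move=> mD x0 y0 s1 s2.
have i1 := square_integrable_integrable s1; have i2 := square_integrable_integrable s2.
have i12 : mu.-integrable D (EFin \o (fun t => `|w1 t + w2 t| ^+ 2)).
  have s2N : square_integrable D (0 - w2).
    exact: square_integrableB (square_integrable0 _) s2.
  have := square_integrable_integrable (square_integrableB mD s1 s2N).
  congr (_.-integrable _ _); apply/funext => t /=.
  by rewrite -[(_ - _) t]/(w1 t - (0 - w2 t)) sub0r opprK.
have i1x := integrableZl mD ((x + y) / x) i1.
have i2y := integrableZl mD ((x + y) / y) i2.
rewrite -!RintegralZl// -RintegralD//; apply: le_Rintegral => //.
  exact: (integrableD mD i1x i2y).
by move=> t _; exact: youngD.
Qed.

(** The bound is optimal for x and y the square roots of X and Y, which may
    vanish; shifting both by e / 2 keeps the weights positive at the cost of an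
    arbitrarily small e. *)
Lemma sqrt_le_of_young (X Y Z : R) : 0 <= X -> 0 <= Y ->
  (forall x y, 0 < x -> 0 < y -> Z <= (x + y) / x * X + (x + y) / y * Y) ->
  Num.sqrt Z <= Num.sqrt X + Num.sqrt Y.
Proof.
move=> X0 Y0 h; apply/ler_addgt0Pr => e e0.
pose x := Num.sqrt X + e / 2; pose y := Num.sqrt Y + e / 2.
have e2 : 0 < e / 2 by rewrite divr_gt0.
have x0 : 0 < x by rewrite ltr_wpDl// sqrtr_ge0.
have y0 : 0 < y by rewrite ltr_wpDl// sqrtr_ge0.
have sq A : 0 <= A -> A <= (Num.sqrt A + e / 2) ^+ 2.
  move=> A0; rewrite -[leLHS]sqr_sqrtr// lerXn2r ?nnegrE ?addr_ge0 ?sqrtr_ge0 ?ltW//.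
  by rewrite ltrDl.
rewrite (_ : _ + e = x + y); last by rewrite /x /y; field.
have xy : 0 <= x + y by rewrite addr_ge0// ltW.
have -> : x + y = Num.sqrt ((x + y) ^+ 2) by rewrite sqrtr_sqr ger0_norm.
apply: ler_wsqrtr.
apply: le_trans (h _ _ x0 y0) _.
rewrite (_ : _ ^+ 2 = (x + y) / x * x ^+ 2 + (x + y) / y * y ^+ 2); last first.
  by field; rewrite !gt_eqF.
by apply: lerD; apply: ler_wpM2l; rewrite ?divr_ge0 ?sq// ltW.
Qed.
End minkowski.

(** * The triangle inequality for the Sobolev norm *)

Section sobolev_triangle.
Context {R : realType} {d : nat} (D : domain R d) (s : R).
Local Notation mu := (@lebesgue_rV R d).
Implicit Types (u v : sobolev_fun D s) (a b : sobolev D s).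

Let mD : measurable D.
Proof. by apply: rV_open_measurable; exact: domain_open. Qed.

(** Membership in the Sobolev space gives some square integrable weak derivative,
    not the chosen one; they agree almost everywhere on D. *)
Lemma weak_derivP u alpha : multi_index s alpha ->
  weak_derivative D alpha u (weak_deriv D alpha u) /\
  square_integrable D (weak_deriv D alpha u).
Proof.
move=> sa; have [w uw sw] : exists2 w, weak_derivative D alpha u w & square_integrable D w.
  by case: u => u /= ; rewrite inE; exact.
have uw' : weak_derivative D alpha u (weak_deriv D alpha u).
  by apply: (@xgetPex _ _ [set w | weak_derivative D alpha u w]); exists w.
split=> //; apply: square_integrable_ae sw => //; first by case: uw' => _ [].
exact: (weak_derivative_ae_unique (@domain_open _ _ D) uw uw').
Qed.

(** The projection on classes is additive, and its kernel consists of the null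
    functions. *)
Lemma repr_sobolevD a b : {ae mu, forall x, domain_set D x ->
  (repr (a + b) - repr a - repr b : sobolev_fun D s) x = 0}.
Proof.
suff : (repr (a + b) - repr a - repr b : sobolev_fun D s) \in @sobolev_null _ _ D s.
  by rewrite inE.
rewrite -addrA -opprD (Quotient.idealrBE (@sobolev_null _ _ D s)).
by apply/eqP; rewrite reprK Quotient.pi_add !reprK.
Qed.

Lemma weak_derivD a b alpha : multi_index s alpha ->
  {ae mu, forall x, domain_set D x -> weak_deriv D alpha (repr (a + b) : sobolev_fun D s) x =
    weak_deriv D alpha (repr a : sobolev_fun D s) x +
    weak_deriv D alpha (repr b : sobolev_fun D s) x}.
Proof.
move=> sa.
have [dab _] := weak_derivP (repr (a + b)) sa.
have [da _] := weak_derivP (repr a) sa; have [db _] := weak_derivP (repr b) sa.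
have := weak_derivative_ae0 (@domain_open _ _ D) (repr_sobolevD a b)
  (weak_derivativeB mD (weak_derivativeB mD dab da) db).
apply: filterS => x hx /hx; rewrite -[LHS]/(_ - _ - _) => /eqP.
by rewrite -addrA -opprD subr_eq0 => /eqP.
Qed.

Lemma sobolev_normE a : sobolev_norm a =
  Num.sqrt (\sum_(alpha <- finmap.enum_fset (fset_set (@multi_index R d s)))
    \int[mu]_(x in D) `|weak_deriv D alpha (repr a : sobolev_fun D s) x| ^+ 2).
Proof.
rewrite /sobolev_norm; congr Num.sqrt.
exact/fsbig_finite/finite_multi_index.
Qed.

(** Minkowski's inequality, reduced by [sqrt_le_of_young] to an inequality that
    can be checked for each multi-index separately. *)
Lemma sobolev_normD a b : sobolev_norm (a + b) <= sobolev_norm a + sobolev_norm b.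
Proof.
rewrite (sobolev_normE (a + b)) (sobolev_normE a) (sobolev_normE b).
apply: sqrt_le_of_young.
- by apply: sumr_ge0 => alpha _; apply: Rintegral_ge0 => x _; rewrite exprn_ge0.
- by apply: sumr_ge0 => alpha _; apply: Rintegral_ge0 => x _; rewrite exprn_ge0.
move=> x y x0 y0; rewrite !mulr_sumr -big_split/= big_seq [leRHS]big_seq.
apply: ler_sum => alpha; rewrite in_fset_set; last exact: finite_multi_index.
rewrite inE => sa.
have [_ sab] := weak_derivP (repr (a + b)) sa.
have [_ sqa] := weak_derivP (repr a) sa; have [_ sqb] := weak_derivP (repr b) sa.
apply: le_trans (Rintegral_youngD mD x0 y0 sqa sqb).
rewrite le_eqVlt; apply/orP; left; apply/eqP; apply: ae_eq_Rintegral => //.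
- by apply/measurable_funX/measurableT_comp => //; case: sab.
- apply/measurable_funX/measurableT_comp => //.
  by apply: measurable_funD; [case: sqa|case: sqb].
- by apply: filterS (weak_derivD a b sa) => t ht /ht ->.
Qed.
End sobolev_triangle.

Theorem theorem3p1 (R : realType) (d : nat) (D : domain R d) (s t : R)
    (hs : 0 <= s) (ht : 0 <= t) (Theta : Type)
    (G : Theta -> sobolev D s -> sobolev D t) (theta : Theta) (L : R)
    (hL : 0 < L)
    (lipschitz : forall u v : sobolev D s,
      sobolev_norm (G theta u - G theta v) <= L * sobolev_norm (u - v)) :
  forall u : sobolev D s,
    sobolev_norm (G theta u) <=
      L * sobolev_norm u + sobolev_norm (G theta 0).
Proof.
move=> u; rewrite -[in leLHS](subrK (G theta 0) (G theta u)).
apply: le_trans (sobolev_normD _ _) _; rewrite lerD2r.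
by have := lipschitz u 0; rewrite subr0.
Qed.
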